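(* The search problem Categorized Pigeon is $\mathsf{PPP}$-hard.
   Context: Categorized Pigeon: given Boolean circuits $p:\{0,1\}^{m_1+m_2}\to\{0,1\}^{m_1}$, $h:\{0,1\}^{m_1+m_2}\to\{0,1\}^{m_2}$ and a list of $k$ removed elements $\Pi=\{\pi_1,\dots,\pi_k\}\subseteq\{0,1\}^{m_1+m_2}$ with $k<2^{m_1}$, find either (1) $x\in\{0,1\}^{m_1+m_2}\setminus\Pi$ with $h(x)\in h(\Pi)$, or (2) two distinct $x,y\in\{0,1\}^{m_1+m_2}\setminus\Pi$ with $p(x)=p(y)$ and $h(x)=h(y)$. Pigeon: given a Boolean circuit $f:\{0,1\}^n\to\{0,1\}^n$ and $v^*\in\{0,1\}^n$, find either $x$ with $f(x)=v^*$ or two distinct $x,y$ with $f(x)=f(y)$. $\mathsf{PPP}$ is the class of search problems polynomial-time reducible to Pigeon (a reduction from $R$ to $S$ being polynomial-time computable $f,g$ such that whenever $y$ solves $S$ on $f(x)$, $g(x,y)$ solves $R$ on $x$). A problem is $\mathsf{PPP}$-hard if every problem in $\mathsf{PPP}$ reduces to it. *)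

(* Defs.v *)
From mathcomp Require Import all_boot all_order all_algebra.

Set Implicit Arguments.
Unset Strict Implicit.
Unset Printing Implicit Defensive.

Notation bits := (seq bool).

(** * Polynomial time: deterministic multi-tape Turing machines *)

(* [None] is the blank; [G] is the set of tape symbols other than 0, 1, blank. *)
Definition symbol (G : finType) := option (bool + G)%type.

Inductive direction := Left | Stay | Right.

Definition move (d : direction) (z : int) : int :=
  match d with
  | Left => (z - 1)%R
  | Stay => z
  | Right => (z + 1)%R
  end.

(* Tapes 0 and 1 are the input tapes and tape 0 is also the output tape. *)
Record tm := TM {
  tm_work : nat;
  tm_extra : finType;
  tm_state : finType;
  tm_start : tm_state;
  tm_halt : pred tm_state;
  tm_delta : tm_state -> {ffun 'I_tm_work.+2 -> symbol tm_extra} ->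
    tm_state * {ffun 'I_tm_work.+2 -> symbol tm_extra * direction}
}.

(* Tapes are infinite in both directions. *)
Record config (M : tm) := Config {
  cf_state : tm_state M;
  cf_head : 'I_(tm_work M).+2 -> int;
  cf_cell : 'I_(tm_work M).+2 -> int -> symbol (tm_extra M)
}.

Definition tm_step (M : tm) (c : config M) : config M :=
  if tm_halt (cf_state c) then c else
  let r := tm_delta (cf_state c) [ffun i => cf_cell c i (cf_head c i)] in
  Config r.1
    (fun i => move (r.2 i).2 (cf_head c i))
    (fun i z => if z == cf_head c i then (r.2 i).1 else cf_cell c i z).

Definition tape_of (G : finType) (s : bits) (z : int) : symbol G :=
  match z with
  | Posz i => if i < size s then Some (inl (nth false s i)) else None
  | Negz _ => None
  end.

Definition tm_init (M : tm) (x y : bits) : config M :=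
  Config (tm_start M) (fun _ => 0%R)
    (fun i => tape_of (tm_extra M) (nth [::] [:: x; y] i)).

(* On inputs [x], [y] the machine halts after at most [t] steps, with exactly
   [out] on tape 0 and the head of tape 0 back on cell 0. *)
Definition tm_outputs (M : tm) (x y out : bits) (t : nat) : Prop :=
  let c := iter t (@tm_step M) (tm_init M x y) in
  [/\ tm_halt (cf_state c), cf_head c ord0 = 0%R
    & cf_cell c ord0 =1 tape_of (tm_extra M) out].

Definition polytime2 (g : bits -> bits -> bits) : Prop :=
  exists (M : tm) (a d : nat), forall x y,
    tm_outputs M x y (g x y) (a * (size x + size y) ^ d + a).

Definition polytime1 (f : bits -> bits) : Prop :=
  exists (M : tm) (a d : nat), forall x,
    tm_outputs M x [::] (f x) (a * size x ^ d + a).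

(** * Search problems and reductions *)

(* The instance set is explicit: a reduction has to produce genuine instances,
   since on a string with no solutions the second condition on reductions
   would hold vacuously. *)
Record search_problem := SearchProblem {
  is_instance : bits -> Prop;
  is_solution : bits -> bits -> Prop
}.

Definition reduces (R S : search_problem) : Prop :=
  exists (f : bits -> bits) (g : bits -> bits -> bits),
  [/\ polytime1 f, polytime2 g,
      forall x, is_instance R x -> is_instance S (f x)
    & forall x y, is_instance R x ->
        is_solution S (f x) y -> is_solution R x (g x y)].

(** * Boolean circuits *)

(* A circuit is a straight-line program: operands of [GNot], [GAnd], [GOr] are
   positions of earlier gates, and [GInput i] reads the [i]-th input bit. *)
Inductive gate :=
  | GInput of nat
  | GConst of bool
  | GNot of nat
  | GAnd of nat & nat
  | GOr of nat & nat.

Record circuit := Circuit { gates : seq gate; outputs : seq nat }.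

(* [n] is the number of inputs, [t] the position of the gate. *)
Definition gate_wf (n t : nat) (g : gate) : bool :=
  match g with
  | GInput i => i < n
  | GConst _ => true
  | GNot i => i < t
  | GAnd i j | GOr i j => (i < t) && (j < t)
  end.

(* [c] is a circuit computing a map {0,1}^n -> {0,1}^m. *)
Definition circuit_wf (n m : nat) (c : circuit) : bool :=
  [&& all (fun t => gate_wf n t (nth (GConst false) (gates c) t))
          (iota 0 (size (gates c))),
      all (fun j => j < size (gates c)) (outputs c)
    & size (outputs c) == m].

Definition gate_val (x vals : bits) (g : gate) : bool :=
  match g with
  | GInput i => nth false x i
  | GConst b => b
  | GNot i => ~~ nth false vals i
  | GAnd i j => nth false vals i && nth false vals j
  | GOr i j => nth false vals i || nth false vals j
  end.

Definition gate_vals (x : bits) (gs : seq gate) : bits :=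
  foldl (fun vals g => rcons vals (gate_val x vals g)) [::] gs.

Definition eval (c : circuit) (x : bits) : bits :=
  [seq nth false (gate_vals x (gates c)) j | j <- outputs c].

(** * Encodings as bit strings *)

(* All encodings are prefix codes, so that concatenations decode uniquely.
   Unary numbers are harmless: every number encoded is bounded by the number
   of inputs, gates or outputs of a circuit of the instance, and the number of
   inputs is the total number of outputs ([n], or [m1 + m2]). *)
Definition enc_nat (n : nat) : bits := rcons (nseq n true) false.

Definition enc_seq (T : Type) (enc : T -> bits) (s : seq T) : bits :=
  rcons (flatten [seq true :: enc u | u <- s]) false.

Definition enc_bits : bits -> bits := enc_seq (fun b => [:: b]).

Definition enc_gate (g : gate) : bits :=
  match g with
  | GInput i => enc_nat 0 ++ enc_nat i
  | GConst b => enc_nat 1 ++ [:: b]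
  | GNot i => enc_nat 2 ++ enc_nat i
  | GAnd i j => enc_nat 3 ++ enc_nat i ++ enc_nat j
  | GOr i j => enc_nat 4 ++ enc_nat i ++ enc_nat j
  end.

Definition enc_circuit (c : circuit) : bits :=
  enc_seq enc_gate (gates c) ++ enc_seq enc_nat (outputs c).

(* Solutions of both problems are either one string or a pair of strings. *)
Inductive witness := One of bits | Two of bits & bits.

Definition enc_witness (w : witness) : bits :=
  match w with
  | One x => false :: enc_bits x
  | Two x y => true :: enc_bits x ++ enc_bits y
  end.

Definition encoded_problem (I : Type) (valid : I -> Prop) (enc : I -> bits)
    (solves : I -> witness -> Prop) : search_problem :=
  SearchProblem
    (fun u => exists2 a, valid a & u = enc a)
    (fun u v => exists a w,
       [/\ valid a, u = enc a, v = enc_witness w & solves a w]).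

(** * Pigeon *)

Record pigeon_data := PigeonData {
  pg_n : nat;
  pg_f : circuit;
  pg_v : bits
}.

Definition pigeon_valid (a : pigeon_data) : Prop :=
  circuit_wf (pg_n a) (pg_n a) (pg_f a) /\ size (pg_v a) = pg_n a.

Definition pigeon_enc (a : pigeon_data) : bits :=
  enc_nat (pg_n a) ++ enc_circuit (pg_f a) ++ enc_bits (pg_v a).

Definition pigeon_solves (a : pigeon_data) (w : witness) : Prop :=
  match w with
  | One x => size x = pg_n a /\ eval (pg_f a) x = pg_v a
  | Two x y => [/\ size x = pg_n a, size y = pg_n a, x <> y
                 & eval (pg_f a) x = eval (pg_f a) y]
  end.

Definition Pigeon : search_problem :=
  encoded_problem pigeon_valid pigeon_enc pigeon_solves.

(** * Categorized Pigeon *)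

Record catpigeon_data := CatPigeonData {
  cp_m1 : nat;
  cp_m2 : nat;
  cp_p : circuit;
  cp_h : circuit;
  cp_Pi : seq bits
}.

(* At least one element is removed: for an empty list there may be no solution,
   e.g. when x |-> (p(x), h(x)) is a bijection. *)
Definition catpigeon_valid (a : catpigeon_data) : Prop :=
  [/\ circuit_wf (cp_m1 a + cp_m2 a) (cp_m1 a) (cp_p a),
      circuit_wf (cp_m1 a + cp_m2 a) (cp_m2 a) (cp_h a),
      all (fun u => size u == cp_m1 a + cp_m2 a) (cp_Pi a),
      uniq (cp_Pi a)
    & 0 < size (cp_Pi a) < 2 ^ cp_m1 a].

Definition catpigeon_enc (a : catpigeon_data) : bits :=
  enc_nat (cp_m1 a) ++ enc_nat (cp_m2 a) ++ enc_circuit (cp_p a) ++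
  enc_circuit (cp_h a) ++ enc_seq enc_bits (cp_Pi a).

Definition remaining (a : catpigeon_data) (x : bits) : Prop :=
  size x = cp_m1 a + cp_m2 a /\ x \notin cp_Pi a.

Definition catpigeon_solves (a : catpigeon_data) (w : witness) : Prop :=
  match w with
  | One x => remaining a x /\
      eval (cp_h a) x \in [seq eval (cp_h a) u | u <- cp_Pi a]
  | Two x y => [/\ remaining a x, remaining a y, x <> y,
      eval (cp_p a) x = eval (cp_p a) y & eval (cp_h a) x = eval (cp_h a) y]
  end.

Definition CategorizedPigeon : search_problem :=
  encoded_problem catpigeon_valid catpigeon_enc catpigeon_solves.

(** * PPP *)

Definition in_PPP (R : search_problem) : Prop := reduces R Pigeon.

Definition PPP_hard (S : search_problem) : Prop :=
  forall R : search_problem, in_PPP R -> reduces R S.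

(* Main.v *)
Require Import Defs.
From mathcomp Require Import all_boot all_order all_algebra.
From HB Require Import structures.
From mathcomp Require Import zify.
From Stdlib Require Import FunctionalExtensionality.

Set Implicit Arguments.
Unset Strict Implicit.
Unset Printing Implicit Defensive.

(** Reductions compose, so it suffices to reduce Pigeon to Categorized Pigeon.
    Given [f] on [n] bits and [v], take [m1 = 1], [m2 = n] and, on an input
    [b :: x], let [p] be [b] and [h] be [if b then f x else x]; remove only
    [false :: v], so that [h] maps the removed element to [v]. As [h] is
    injective where [b] is false, a remaining element with [h = v] has [b] true
    and [f x = v], and a collision lies where [b] is true and is one of [f]:
    dropping the first bits translates the solutions back.

    Both translations are one-pass transductions that append to output streams,
    possibly copying unary counters. Every such transduction is computed by a
    Turing machine in polynomial time, on ill-formed inputs too. *)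

(** * Polynomial bounds *)

(** The combinatorics is short; the length comes from [polytime1] and [polytime2], which ask for
    actual machines. Two features of the encoding shape the class of transductions. Gates refer to
    each other by absolute position in unary, so a translation that sees its input once must
    remember how many gates it has written: hence counters. An output reference [o] of the circuit
    of [f] gives rise both to new gates and to a new output reference, but all gates precede all
    outputs in an encoding: hence a second stream, which holds back the outputs until the end.
    Counters grow by a bounded amount per input bit and are copied boundedly often per bit, so the
    output stays polynomial. The width [m1 = 1] is the least that permits a removed element, as
    [0 < 1 < 2 ^ 1]. *)

Definition poly_bounded (F : nat -> nat) : Prop :=
  exists a d, forall n, F n <= a * n ^ d + a.

Lemma leq_expn_base (m n d : nat) : m <= n -> m ^ d <= n ^ d.
Proof. by case: d => // d mn; rewrite leq_exp2r. Qed.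

(** Powers of [n.+1] are positive and grow with the exponent, so in this form bounds are added and
    multiplied by adding exponents; with [n ^ d] this fails at [n = 0]. *)
Lemma poly_boundedP (F : nat -> nat) :
  poly_bounded F <-> exists a d, forall n, F n <= a * n.+1 ^ d.
Proof.
split=> [[a [d FE]] | [a [d FE]]].
  exists (a + a), d => n; apply: leq_trans (FE n) _.
  rewrite mulnDl leq_add //; first by rewrite leq_mul2l leq_expn_base ?orbT.
  by rewrite leq_pmulr // expn_gt0.
exists (a * 2 ^ d), d => n; apply: leq_trans (FE n) _.
rewrite -mulnA -expnMn; case: n => [|n].
  by apply: leq_trans (leq_addl _ _); rewrite exp1n leq_mul2l expn_gt0 orbT.
apply: leq_trans (leq_addr _ _); rewrite leq_mul2l leq_expn_base ?orbT //; lia.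
Qed.

Lemma poly_bounded_le (F G : nat -> nat) :
  (forall n, F n <= G n) -> poly_bounded G -> poly_bounded F.
Proof. by move=> FG [a [d GE]]; exists a, d => n; apply: leq_trans (GE n). Qed.

Lemma poly_bounded_const (c : nat) : poly_bounded (fun=> c).
Proof. by exists c, 0 => n; lia. Qed.

Lemma poly_bounded_id : poly_bounded id.
Proof. by exists 1, 1 => n; rewrite expn1; lia. Qed.

Lemma poly_boundedM (F G : nat -> nat) :
  poly_bounded F -> poly_bounded G -> poly_bounded (fun n => F n * G n).
Proof.
move=> /poly_boundedP[a [d FE]] /poly_boundedP[b [e GE]].
apply/poly_boundedP; exists (a * b), (d + e) => n.
by rewrite expnD mulnACA leq_mul.
Qed.

Lemma poly_boundedD (F G : nat -> nat) :
  poly_bounded F -> poly_bounded G -> poly_bounded (fun n => F n + G n).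
Proof.
move=> /poly_boundedP[a [d FE]] /poly_boundedP[b [e GE]].
apply/poly_boundedP; exists (a + b), (d + e) => n.
rewrite mulnDl expnD leq_add //.
  by apply: leq_trans (FE n) _; rewrite leq_mul2l leq_pmulr ?orbT // expn_gt0.
by apply: leq_trans (GE n) _; rewrite leq_mul2l leq_pmull ?orbT // expn_gt0.
Qed.

Lemma poly_boundedS (F : nat -> nat) :
  poly_bounded F -> poly_bounded (fun n => (F n).+1).
Proof.
move=> /poly_boundedD/(_ (poly_bounded_const 1)).
by apply: poly_bounded_le => n; rewrite addn1.
Qed.

Lemma poly_boundedX (F : nat -> nat) (d : nat) :
  poly_bounded F -> poly_bounded (fun n => F n ^ d).
Proof.
move=> FE; elim: d => [|d IHd]; first exact: poly_bounded_const.
by apply: poly_bounded_le (poly_boundedM FE IHd) => n; rewrite expnS.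
Qed.

(** * Simulating a machine on some of the tapes of a larger one *)

Definition up_sym (G H : Type) (up : G -> H) (s : option (bool + G)) : option (bool + H) :=
  match s with
  | Some (inr g) => Some (inr (up g))
  | Some (inl b) => Some (inl b)
  | None => None
  end.

Definition down_sym (G H : Type) (down : H -> option G) (s : option (bool + H)) :
    option (bool + G) :=
  match s with
  | Some (inr g) => omap inr (down g)
  | Some (inl b) => Some (inl b)
  | None => None
  end.

Lemma up_symK (G H : Type) (up : G -> H) (down : H -> option G) :
  pcancel up down -> cancel (up_sym up) (down_sym down).
Proof. by move=> upK [[b|g]|] //=; rewrite upK. Qed.

Lemma up_sym_tape (G H : finType) (up : G -> H) (s : bits) (z : int) :
  up_sym up (tape_of G s z) = tape_of H s z.
Proof. by case: z => //= i; case: ifP. Qed.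

(* Tape [i] of [M] is played on tape [e i]; symbols on which
   [down] fails are read as blanks. *)
Definition embed_delta (M : tm) (k : nat) (e : 'I_(tm_work M).+2 -> 'I_k)
    (G S : finType) (up : tm_extra M -> G) (down : G -> option (tm_extra M))
    (inj_state : tm_state M -> S) (s : tm_state M) (syms : {ffun 'I_k -> symbol G}) :
    S * {ffun 'I_k -> symbol G * direction} :=
  let r := tm_delta s [ffun i => down_sym down (syms (e i))] in
  (inj_state r.1,
   [ffun j => if [pick i | e i == j] is Some i
              then (up_sym up (r.2 i).1, (r.2 i).2) else (syms j, Stay)]).

Section Simulation.

Variables (M M' : tm) (e : 'I_(tm_work M).+2 -> 'I_(tm_work M').+2).
Variables (up : tm_extra M -> tm_extra M') (down : tm_extra M' -> option (tm_extra M)).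
Variable inj_state : tm_state M -> tm_state M'.

Hypothesis e_inj : injective e.
Hypothesis upK : pcancel up down.
Hypothesis halt_inj : forall s, ~~ tm_halt s -> tm_halt (inj_state s) = false.
Hypothesis delta_inj : forall s syms, ~~ tm_halt s ->
  tm_delta (inj_state s) syms = embed_delta e up down inj_state s syms.

Definition simulates (c : config M) (c' : config M') : Prop :=
  [/\ cf_state c' = inj_state (cf_state c),
      forall i, cf_head c' (e i) = cf_head c i
    & forall i z, cf_cell c' (e i) z = up_sym up (cf_cell c i z)].

(** In a composition, the second machine relies on finding its own tapes as they were before the
    first one ran. *)
Definition same_frame (c' d' : config M') : Prop :=
  forall j, (forall i, e i != j) ->
    cf_head c' j = cf_head d' j /\ cf_cell c' j =1 cf_cell d' j.

Lemma simulates_step (c : config M) (c' : config M') :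
  simulates c c' -> ~~ tm_halt (cf_state c) ->
  simulates (tm_step c) (tm_step c') /\ same_frame (tm_step c') c'.
Proof.
move=> [cs ch cc] nh; rewrite /tm_step cs halt_inj // (negbTE nh) delta_inj //.
rewrite /embed_delta.
have -> : [ffun i => down_sym down ([ffun i0 => cf_cell c' i0 (cf_head c' i0)] (e i))]
    = [ffun i => cf_cell c i (cf_head c i)].
  by apply/ffunP=> i; rewrite !ffunE ch cc up_symK.
set r := tm_delta _ _.
have pickE i : [pick k | e k == e i] = Some i.
  case: pickP => [k /eqP/e_inj -> //|/(_ i)]; by rewrite eqxx.
split; first split=> //= i.
- by rewrite ffunE pickE ch.
- by move=> z; rewrite ffunE pickE ch; case: eqP.
move=> j ej /=; have pickN : [pick k | e k == j] = None.
  by case: pickP => // k; rewrite (negbTE (ej k)).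
split=> [|z]; rewrite ffunE pickN //= ffunE; by case: eqP => // ->.
Qed.

(** The count [n'] may be smaller than [n]: a halted [M] repeats its configuration, whereas its
    image in [M'] need not be halting and may go on. *)
Lemma simulates_iter (n : nat) (c : config M) (c' : config M') :
  simulates c c' ->
  exists n', [/\ n' <= n, simulates (iter n (@tm_step M) c) (iter n' (@tm_step M') c')
    & same_frame (iter n' (@tm_step M') c') c'].
Proof.
elim: n c c' => [|n IHn] c c' sim; first by exists 0; split=> // j _.
have [hc|nh] := boolP (tm_halt (cf_state c)).
  have [n' [n'n sim' fr]] := IHn _ _ sim.
  by exists n'; split=> //; [exact: leqW | rewrite iterSr /tm_step hc].
have [sim1 fr1] := simulates_step sim nh.
have [n' [n'n sim' fr]] := IHn _ _ sim1.
exists n'.+1; split=> //; first by rewrite !iterSr.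
move=> j ej; rewrite iterSr.
have [h1 c1] := fr1 j ej; have [h2 c2] := fr j ej.
by split=> [|z]; [rewrite h2 h1 | rewrite c2 c1].
Qed.

End Simulation.

(** * Sequential composition *)

Lemma iter_halted (M : tm) (n : nat) (c : config M) :
  tm_halt (cf_state c) -> iter n (@tm_step M) c = c.
Proof. by move=> hc; elim: n => //= n ->; rewrite /tm_step hc. Qed.

Lemma tm_outputs_leq (M : tm) (x y out : bits) (t u : nat) :
  t <= u -> tm_outputs M x y out t -> tm_outputs M x y out u.
Proof. by move=> tu [h1 h2 h3]; rewrite /tm_outputs -(subnK tu) iterD iter_halted. Qed.

Definition keep (k : nat) (A : Type) (syms : {ffun 'I_k -> A}) :
  {ffun 'I_k -> A * direction} := [ffun j => (syms j, Stay)].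

Section Sequence.

Variables (M1 M2 : tm) (w : nat).
Variables (e1 : 'I_(tm_work M1).+2 -> 'I_w.+2) (e2 : 'I_(tm_work M2).+2 -> 'I_w.+2).
Hypotheses (e1_inj : injective e1) (e2_inj : injective e2).

Let downl (g : tm_extra M1 + tm_extra M2) := if g is inl u then Some u else None.
Let downr (g : tm_extra M1 + tm_extra M2) := if g is inr u then Some u else None.

Definition tm_seq : tm :=
  @TM w (tm_extra M1 + tm_extra M2)%type (tm_state M1 + tm_state M2)%type
    (inl (tm_start M1))
    (fun s => if s is inr s2 then tm_halt s2 else false)
    (fun s syms =>
       match s with
       | inl s1 => if tm_halt s1 then (inr (tm_start M2), keep syms)
                   else embed_delta e1 inl downl inl s1 syms
       | inr s2 => embed_delta e2 inr downr inr s2 syms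
       end).

(** Each tape of [M2] is either the output tape of [M1], whose head [tm_outputs] guarantees to be
    back on cell 0, or one that [M1] never touches. The extra step is the hand-over. *)
Lemma tm_seq_outputs (x y x1 y1 o1 x2 y2 out : bits) (t1 t2 : nat) :
  (forall i, nth [::] [:: x; y] (e1 i) = nth [::] [:: x1; y1] i) ->
  (forall i, (e2 i = e1 ord0 /\ nth [::] [:: x2; y2] i = o1) \/
     (forall k, e1 k != e2 i) /\ nth [::] [:: x; y] (e2 i) = nth [::] [:: x2; y2] i) ->
  e2 ord0 = ord0 ->
  tm_outputs M1 x1 y1 o1 t1 -> tm_outputs M2 x2 y2 out t2 ->
  tm_outputs tm_seq x y out (t2 + t1.+1).
Proof.
move=> in1 in2 e20 [hs1 hh1 hc1] [hs2 hh2 hc2].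
pose up1 : tm_extra M1 -> tm_extra tm_seq := inl.
pose up2 : tm_extra M2 -> tm_extra tm_seq := inr.
pose st1 : tm_state M1 -> tm_state tm_seq := inl.
pose st2 : tm_state M2 -> tm_state tm_seq := inr.
have sim0 : simulates (M' := tm_seq) e1 up1 st1 (tm_init M1 x1 y1) (tm_init tm_seq x y).
  by split=> // i z /=; rewrite up_sym_tape in1.
have [n1 [n1t [s1 h1 c1] fr1]] : exists n', [/\ n' <= t1,
    simulates (M' := tm_seq) e1 up1 st1 (iter t1 (@tm_step M1) (tm_init M1 x1 y1))
       (iter n' (@tm_step tm_seq) (tm_init tm_seq x y))
    & same_frame (M' := tm_seq) e1 (iter n' (@tm_step tm_seq) (tm_init tm_seq x y))
       (tm_init tm_seq x y)].
  by apply: (@simulates_iter M1 tm_seq e1 up1 downl) => //= s syms /negbTE ->.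
move: s1 h1 c1 fr1; set c1' := iter n1 _ _ => s1 h1 c1 fr1.
move: hs1 hh1 hc1 s1 h1 c1; set m1 := iter t1 _ _ => hs1 hh1 hc1 s1 h1 c1.
(* The hand-over writes back what it reads, so only the state changes. *)
have mid : simulates (M' := tm_seq) e2 up2 st2 (tm_init M2 x2 y2) (tm_step c1').
  rewrite /tm_step s1 /= hs1; split=> //= i.
    rewrite ffunE /=; case: (in2 i) => [[-> _]|[ne _]]; first by rewrite h1.
    by have [-> _] := fr1 _ ne.
  move=> z; rewrite !ffunE /=.
  have -> : (if z == cf_head c1' (e2 i) then cf_cell c1' (e2 i) (cf_head c1' (e2 i))
     else cf_cell c1' (e2 i) z) = cf_cell c1' (e2 i) z by case: eqP => // ->.
  rewrite up_sym_tape; case: (in2 i) => [[-> ->]|[ne <-]].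
    by rewrite c1 hc1 up_sym_tape.
  by have [_ ->] := fr1 _ ne.
have [n2 [n2t [s2 h2 c2] _]] : exists n', [/\ n' <= t2,
    simulates (M' := tm_seq) e2 up2 st2 (iter t2 (@tm_step M2) (tm_init M2 x2 y2))
       (iter n' (@tm_step tm_seq) (tm_step c1'))
    & same_frame (M' := tm_seq) e2 (iter n' (@tm_step tm_seq) (tm_step c1')) (tm_step c1')].
  by apply: (@simulates_iter M2 tm_seq e2 up2 downr) => //= s /negbTE.
apply: (@tm_outputs_leq _ _ _ _ (n2 + n1.+1)); first by lia.
rewrite /tm_outputs iterD iterS -/c1'; split.
- by rewrite s2.
- by rewrite -e20 h2.
- by move=> z; rewrite -e20 c2 hc2 up_sym_tape.
Qed.

End Sequence.

(** After [t] steps the head is at cell [t] at most, so the cells from [size x + t] on are still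
    blank. This bounds the input of the second machine of a composition. *)
Lemma size_output (M : tm) (x y out : bits) (t : nat) :
  tm_outputs M x y out t -> size out <= size x + t.
Proof.
move=> [_ _ oute].
have [_ blank] : (cf_head (iter t (@tm_step M) (tm_init M x y)) ord0 <= Posz t)%R /\
    forall i : nat, size x + t <= i ->
      cf_cell (iter t (@tm_step M) (tm_init M x y)) ord0 (Posz i) = None.
  elim: t {oute} => [|t [IHh IHc]] /=.
    by split=> // i; rewrite addn0 => xi; rewrite ltnNge xi.
  move: IHh IHc; set c := iter t _ _ => IHh IHc; rewrite /tm_step.
  case: ifP => _; first by split=> [|i xi]; [lia | apply: IHc; lia].
  split=> /= [|i xi]; first by case: (_ ord0).2 => /=; lia.
  case: eqP => [ei|_]; last by apply: IHc; lia.
  by move: IHh; rewrite -ei; lia.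
rewrite leqNgt; apply/negP=> lt.
by have := blank _ (leqnn _); rewrite oute /= lt.
Qed.

(* Only tape 0 is shared with the machine on the first [k1] tapes. *)
Definition side_embed (k1 k2 : nat) (s : 'I_k1) (i : 'I_k2) : 'I_(k1 + k2) :=
  if i == 0 :> nat then lshift k2 s else rshift k1 i.

Lemma side_embed_inj (k1 k2 : nat) (s : 'I_k1) : injective (@side_embed k1 k2 s).
Proof.
move=> i j /(congr1 val); rewrite /side_embed.
case: eqP => [i0|_]; case: eqP => [j0|_] /= eq_ij; apply/val_inj => /=.
- by rewrite i0 j0.
- by have := ltn_ord s; lia.
- by have := ltn_ord s; lia.
- by lia.
Qed.

Lemma side_embed_fresh (k1 k2 : nat) (s k : 'I_k1) (i : 'I_k2) :
  i != 0 :> nat -> lshift k2 k != side_embed s i.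
Proof.
move=> /negbTE i0; rewrite /side_embed i0; apply/eqP => /(congr1 val) /=.
by have := ltn_ord k; lia.
Qed.

(** The base of the power [d2] is the bound of [size_output] on the intermediate string; the
    successor pays for the hand-over. *)
Lemma poly_bounded_comp_time (a1 d1 a2 d2 : nat) :
  poly_bounded (fun n => a2 * (n + (a1 * n ^ d1 + a1)) ^ d2 + a2 + (a1 * n ^ d1 + a1).+1).
Proof.
have T1p : poly_bounded (fun n => a1 * n ^ d1 + a1) by exists a1, d1.
apply: poly_boundedD; last exact: poly_boundedS.
apply: poly_boundedD; last exact: poly_bounded_const.
apply: poly_boundedM; first exact: poly_bounded_const.
by apply: poly_boundedX; apply: poly_boundedD => //; apply: poly_bounded_id.
Qed.

Lemma polytime1_comp (f g : bits -> bits) :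
  polytime1 f -> polytime1 g -> polytime1 (g \o f).
Proof.
move=> [M1 [a1 [d1 fM]]] [M2 [a2 [d2 gM]]].
pose k1 := (tm_work M1).+2; pose k2 := (tm_work M2).+2.
have [a [d TE]] := poly_bounded_comp_time a1 d1 a2 d2.
exists (@tm_seq M1 M2 (tm_work M1 + k2) (@lshift k1 k2) (@side_embed k1 k2 ord0)), a, d => x.
apply: tm_outputs_leq (TE _) _.
apply: (@tm_seq_outputs _ _ _ _ _ _ _ _ _ x [::] (f x) (f x) [::]) => //.
- exact: lshift_inj.
- exact: (@side_embed_inj k1 k2 ord0).
- move=> i; have [i0|i0] := eqVneq (i : nat) 0.
    by left; rewrite /side_embed i0.
  right; split=> [k|]; first exact: (@side_embed_fresh k1 k2 ord0).
  rewrite /side_embed (negbTE i0) /=; case: (val i) i0 => // n _ /=.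
  by rewrite nth_nil; case: n => [|n] /=; rewrite ?nth_nil.
- exact: val_inj.
apply: tm_outputs_leq (gM _); rewrite leq_add2r leq_mul2l; apply/orP; right.
exact/leq_expn_base/size_output/fM.
Qed.

(** The machine for [f] plays its tape 0 on tape 1 and the others on fresh tapes, so [x] survives on
    tape 0 and [f y] appears where the machine for [g] expects its second input. *)
Lemma polytime2_comp_right (g : bits -> bits -> bits) (f : bits -> bits) :
  polytime1 f -> polytime2 g -> polytime2 (fun x y => g x (f y)).
Proof.
move=> [M1 [a1 [d1 fM]]] [M2 [a2 [d2 gM]]].
pose k1 := (tm_work M1).+2; pose k2 := (tm_work M2).+2.
have [a [d TE]] := poly_bounded_comp_time a1 d1 a2 d2.
pose one : 'I_k2 := @Ordinal k2 1 isT.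
exists (@tm_seq M1 M2 (tm_work M2 + k1) (@side_embed k2 k1 one) (@lshift k2 k1)), a, d => x y.
apply: tm_outputs_leq (TE _) _.
have le_yxy : a1 * size y ^ d1 + a1 <= a1 * (size x + size y) ^ d1 + a1.
  by rewrite leq_add2r leq_mul2l leq_expn_base ?orbT // leq_addl.
apply: (@tm_seq_outputs _ _ _ _ _ _ _ _ _ y [::] (f y) x (f y)) => //.
- exact: (@side_embed_inj k2 k1 one).
- exact: lshift_inj.
- move=> i; rewrite /side_embed; case: eqP => [-> //|i0].
  by case: (val i) i0 => // n _ /=; rewrite nth_nil; case: n => [|n] /=; rewrite ?nth_nil.
- move=> i; have [i1|i1] := eqVneq (i : nat) 1.
    by left; rewrite i1; split=> //; apply/val_inj.
  right; split=> [k|].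
    by rewrite -val_eqE /side_embed; case: ifP => _ /=; have := ltn_ord i; rewrite /k2; lia.
  by move: i1 => /=; case: (val i) => // -[].
- exact: val_inj.
- exact: tm_outputs_leq le_yxy (fM y).
apply: tm_outputs_leq (gM _ _); rewrite leq_add2r leq_mul2l; apply/orP; right.
apply: leq_expn_base; rewrite -addnA leq_add2l.
by apply: leq_trans (size_output (fM y)) _; rewrite leq_add2l.
Qed.

(** * Counter transducers *)

(* Streams and counters are numbered by booleans; [EmitCounter s c] appends
   counter [c], in unary, to stream [s]. Counters cannot be tested and each input
   bit triggers a fixed list of instructions, whence polynomial time on all inputs. *)
Inductive instr :=
  | Emit of bool & bool
  | EmitCounter of bool & bool
  | Incr of bool.

Record store := Store {
  stream1 : bits;
  stream2 : bits;
  counter1 : nat;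
  counter2 : nat
}.

Definition counter (r : store) (c : bool) : nat :=
  if c then counter2 r else counter1 r.

Definition add_stream (r : store) (s : bool) (u : bits) : store :=
  let: Store a b p j := r in
  if s then Store a (b ++ u) p j else Store (a ++ u) b p j.

Definition exec (r : store) (i : instr) : store :=
  match i with
  | Emit s x => add_stream r s [:: x]
  | EmitCounter s c => add_stream r s (nseq (counter r c) true)
  | Incr c => let: Store a b p j := r in
              if c then Store a b p j.+1 else Store a b p.+1 j
  end.

Record transducer := Transducer {
  tr_state : finType;
  tr_start : tr_state;
  tr_delta : tr_state -> bool -> seq instr * tr_state
}.

Definition tr_step (T : transducer) (qr : tr_state T * store) (x : bool) :
    tr_state T * store :=
  let d := tr_delta qr.1 x in (d.2, foldl exec qr.2 d.1).

Definition transduce (T : transducer) (s : bits) : bits :=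
  let r := (foldl (@tr_step T) (tr_start T, Store [::] [::] 0 0) s).2 in
  stream1 r ++ stream2 r.

(** An instruction raises a counter by at most one, so [B] bounds the counters throughout the list,
    and each append is one bit or one counter long. *)
Lemma exec_bounds (B : nat) (l : seq instr) (r : store) :
  (forall c, counter r c + size l <= B) ->
  let r' := foldl exec r l in
  [/\ forall c, counter r' c <= counter r c + size l,
      size (stream1 r') <= size (stream1 r) + size l * B.+1
    & size (stream2 r') <= size (stream2 r) + size l * B.+1].
Proof.
elim: l r => [|i l IHl] r rB /=; first by split=> [c||]; rewrite ?mul0n ?addn0.
have [hc [h1 h2]] : (forall c, counter (exec r i) c <= (counter r c).+1) /\
    size (stream1 (exec r i)) <= size (stream1 r) + B.+1 /\
    size (stream2 (exec r i)) <= size (stream2 r) + B.+1.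
  move: (rB false) (rB true); case: r {rB IHl} => a b p j /= pB jB.
  case: i => [[] x|[] []|[]] /=; rewrite ?size_cat ?size_nseq /=;
    by split; [case=> /=; lia | lia].
have [|kc k1 k2] := IHl (exec r i).
  by move=> c; move: (hc c) (rB c) => /=; lia.
split=> [c||]; [move: (kc c) (hc c) => /=; lia | |]; rewrite mulSn; lia.
Qed.

(** * Compilation of a transducer to a five-tape machine *)

Section Compile.

Variable T : transducer.

(* [Rewind t er] moves the head of tape [t] back to cell 0, erasing the tape
   if [er]; [Copy t u] copies tape [u], from its head on, to the end of tape [t]. *)
Inductive action :=
  | Push of 'I_5 & bool
  | Rewind of 'I_5 & bool
  | Copy of 'I_5 & 'I_5.

Definition tape_nr (i : nat) (lt_i5 : i < 5) : 'I_5 := Ordinal lt_i5.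

Definition stream_tape (s : bool) : 'I_5 :=
  if s then tape_nr (i := 2) isT else tape_nr (i := 1) isT.
Definition counter_tape (c : bool) : 'I_5 :=
  if c then tape_nr (i := 4) isT else tape_nr (i := 3) isT.

(** Between instructions the heads of streams and counters stand just past the end, so appending is
    a single [Push]; [Copy] brings the rewound counter head back there. *)
Definition compile (i : instr) : seq action :=
  match i with
  | Emit s x => [:: Push (stream_tape s) x]
  | EmitCounter s c =>
    [:: Rewind (counter_tape c) false; Copy (stream_tape s) (counter_tape c)]
  | Incr c => [:: Push (counter_tape c) true]
  end.

(** [tm_outputs] wants exactly the output on tape 0, with its head on cell 0: hence the erasure of
    the input and the last rewind. *)
Definition final_actions : seq action :=
  [:: Rewind ord0 true;
      Rewind (stream_tape false) false; Copy ord0 (stream_tape false);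
      Rewind (stream_tape true) false; Copy ord0 (stream_tape true);
      Rewind ord0 false].

(* [None] stands for the end of the input. *)
Definition actions (q : tr_state T) (x : option bool) : seq action :=
  if x is Some b then flatten [seq compile i | i <- (tr_delta q b).1]
  else final_actions.

(** The constant 6 is the length of [final_actions]. *)
Definition max_actions : nat :=
  maxn 6 (\max_(qx : tr_state T * bool) size (actions qx.1 (Some qx.2))).

Lemma size_actions (q : tr_state T) (x : option bool) :
  size (actions q x) <= max_actions.
Proof.
case: x => [b|]; last by rewrite leq_maxl.
by rewrite leq_max (leq_bigmax (F := fun qx => size (actions qx.1 (Some qx.2))) (q, b)) orbT.
Qed.

Lemma size_instrs (q : tr_state T) (b : bool) : size (tr_delta q b).1 <= max_actions.
Proof.
apply: leq_trans (size_actions q (Some b)) => /=.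
(* Every instruction compiles to at least one action. *)
by elim: (tr_delta q b).1 => //= i l IHl; rewrite size_cat; case: i => /= *; lia.
Qed.

Definition sym := symbol void.

Definition edit (syms : {ffun 'I_5 -> sym}) (t : 'I_5) (s : sym) (d : direction) :
    {ffun 'I_5 -> sym * direction} :=
  [ffun i => if i == t then (s, d) else (syms i, Stay)].

(* The boolean tells whether the action goes on, in its second phase. *)
Definition action_delta (a : action) (phase : bool) (syms : {ffun 'I_5 -> sym}) :
    bool * {ffun 'I_5 -> sym * direction} :=
  match a with
  | Push t x => (false, edit syms t (Some (inl x)) Right)
  | Rewind t er =>
    if ~~ phase then (true, edit syms t (syms t) Left)
    else if syms t is None then (false, edit syms t None Right)
    else (true, edit syms t (if er then None else syms t) Left)
  | Copy t u =>
    if syms u is None then (false, keep syms)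
    else (true, [ffun i => if (i == t) || (i == u) then (syms u, Right)
                           else (syms i, Stay)])
  end.

(* [None] is the halting state, [Some (q, None)] reads the next input bit, and
   [Some (q, Some (x, k, phase))] performs the [k]-th action for [q] and [x]. *)
Definition cstate : finType :=
  option (tr_state T * option (option bool * 'I_max_actions.+1 * bool)).

Definition at_action q x k phase : cstate := Some (q, Some (x, inord k, phase)).

Definition compiled_delta (st : cstate) (syms : {ffun 'I_5 -> sym}) :
    cstate * {ffun 'I_5 -> sym * direction} :=
  match st with
  | None => (None, keep syms)
  | Some (q, None) =>
    if syms ord0 is Some (inl b) then
      (at_action q (Some b) 0 false, edit syms ord0 (syms ord0) Right)
    else (at_action q None 0 false, keep syms)
  | Some (q, Some (x, k, phase)) =>
    if ohead (drop k (actions q x)) is Some a then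
      let r := action_delta a phase syms in
      (if r.1 then at_action q x k true else at_action q x k.+1 false, r.2)
    else (if x is Some b then Some ((tr_delta q b).2, None) else None, keep syms)
  end.

Definition compiled : tm :=
  @TM 3 void cstate (Some (tr_start T, None)) (fun st => st == None) compiled_delta.

(** * Configurations of the compiled machine and bounded reachability *)

Definition upd (A : Type) (f : 'I_5 -> A) (t : 'I_5) (v : A) : 'I_5 -> A :=
  fun i => if i == t then v else f i.

Lemma upd_same (A : Type) (f : 'I_5 -> A) t v : upd f t v t = v.
Proof. by rewrite /upd eqxx. Qed.

Lemma upd_id (A : Type) (f : 'I_5 -> A) t : upd f t (f t) = f.
Proof. by apply: functional_extensionality => i; rewrite /upd; case: eqP => [->|]. Qed.

Lemma upd_upd (A : Type) (f : 'I_5 -> A) t u v : upd (upd f t u) t v = upd f t v.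
Proof. by apply: functional_extensionality => i; rewrite /upd; case: eqP. Qed.

Definition conf (st : cstate) (w : 'I_5 -> bits) (h : 'I_5 -> int) : config compiled :=
  @Config compiled st h (fun i => tape_of void (w i)).

Definition reads (w : 'I_5 -> bits) (h : 'I_5 -> int) : {ffun 'I_5 -> sym} :=
  [ffun i => tape_of void (w i) (h i)].

Lemma readsE w h i : reads w h i = tape_of void (w i) (h i).
Proof. exact: ffunE. Qed.

(** The raw result of a transition, before its tapes are recognized as bit strings again. *)
Definition after (st : cstate) (r : {ffun 'I_5 -> sym * direction}) w h : config compiled :=
  @Config compiled st (fun i => move (r i).2 (h i))
    (fun i z => if z == h i then (r i).1 else tape_of void (w i) z).

Lemma conf_step (st : cstate) w h :
  st != None -> tm_step (conf st w h) =
  after (compiled_delta st (reads w h)).1 (compiled_delta st (reads w h)).2 w h.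
Proof. by move=> /negbTE st0; rewrite /tm_step /= st0. Qed.

Lemma after_keep st w h : after st (keep (reads w h)) w h = conf st w h.
Proof.
congr (@Config compiled); first by apply: functional_extensionality => i; rewrite ffunE.
apply: functional_extensionality => i; apply: functional_extensionality => z.
by rewrite !ffunE; case: eqP => [->|].
Qed.

Lemma after_edit st w h t s d v :
  (forall z, (if z == h t then s else tape_of void (w t) z) = tape_of void v z) ->
  after st (edit (reads w h) t s d) w h = conf st (upd w t v) (upd h t (move d (h t))).
Proof.
move=> vE; congr (@Config compiled); apply: functional_extensionality => i.
  by rewrite ffunE /upd; case: eqP => [->|].
apply: functional_extensionality => z; rewrite !ffunE /upd.
by case: (i =P t) => [->|_] //=; case: eqP => [->|].
Qed.

Lemma after_move st w h t d :
  after st (edit (reads w h) t (reads w h t) d) w h = conf st w (upd h t (move d (h t))).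
Proof.
rewrite (@after_edit _ _ _ _ _ _ (w t)) ?upd_id // => z.
by rewrite ffunE; case: eqP => [->|].
Qed.

Definition reach (n : nat) (c c' : config compiled) : Prop :=
  exists2 k, k <= n & iter k (@tm_step compiled) c = c'.

Lemma reach_trans c2 n1 n2 c1 c3 :
  reach n1 c1 c2 -> reach n2 c2 c3 -> reach (n1 + n2) c1 c3.
Proof.
move=> [k1 k1n <-] [k2 k2n <-]; exists (k1 + k2); first exact: leq_add.
by rewrite addnC iterD.
Qed.

Lemma reach_leq n1 n2 c1 c2 : n1 <= n2 -> reach n1 c1 c2 -> reach n2 c1 c2.
Proof. by move=> n12 [k kn <-]; exists k => //; apply: leq_trans n12. Qed.

Lemma reach_step n c1 c2 : reach n (tm_step c1) c2 -> reach n.+1 c1 c2.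
Proof. by move=> [k kn <-]; exists k.+1 => //; rewrite iterSr. Qed.

Lemma reach1 c1 c2 : tm_step c1 = c2 -> reach 1 c1 c2.
Proof. by move=> <-; exists 1. Qed.

(** * Running a single action *)

Section Action.

Variables (q : tr_state T) (x : option bool) (k : nat) (a : action).
Hypothesis ka : ohead (drop k (actions q x)) = Some a.

Lemma action_step phase w h :
  let r := action_delta a phase (reads w h) in
  tm_step (conf (at_action q x k phase) w h) =
  after (if r.1 then at_action q x k true else at_action q x k.+1 false) r.2 w h.
Proof.
rewrite conf_step //= inordK ?ka //.
have := size_actions q x; have [lt_k|le_k] := ltnP k (size (actions q x)); first by lia.
by move: ka; rewrite drop_oversize.
Qed.

End Action.

Lemma tape_size (s : bits) : tape_of void s (size s) = None.
Proof. by rewrite /= ltnn. Qed.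

Lemma tape_rcons (s : bits) b z :
  (if z == Posz (size s) then Some (inl b) else tape_of void s z) = tape_of void (rcons s b) z.
Proof.
case: z => [i|i] //=; rewrite size_rcons nth_rcons eqz_nat ltnS.
by case: ltngtP.
Qed.

Lemma tape_erase (s : bits) b z :
  (if z == Posz (size s) then None else tape_of void (rcons s b) z) = tape_of void s z.
Proof.
case: z => [i|i] //=; rewrite size_rcons nth_rcons eqz_nat ltnS.
by case: ltngtP.
Qed.

Lemma reach_push q x k t b w (h : 'I_5 -> int) :
  ohead (drop k (actions q x)) = Some (Push t b) -> h t = size (w t) ->
  reach 1 (conf (at_action q x k false) w h)
          (conf (at_action q x k.+1 false) (upd w t (rcons (w t) b))
                (upd h t (Posz (size (w t)).+1))).
Proof.
move=> ka ht; apply: reach1; rewrite (action_step ka) /=.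
rewrite (@after_edit _ _ _ _ _ _ (rcons (w t) b)) => [|z]; last by rewrite ht tape_rcons.
by rewrite ht /=; congr (conf _ _ (upd _ _ _)); lia.
Qed.

(** The first move left is unconditional, so that a blank just past the end is not mistaken for the
    one at cell -1, where the second phase turns back. This makes one step, then [i] moves left,
    then one move right. *)
Lemma reach_rewind q x k t w (h : 'I_5 -> int) i :
  ohead (drop k (actions q x)) = Some (Rewind t false) -> h t = Posz i ->
  i <= size (w t) ->
  reach i.+2 (conf (at_action q x k false) w h)
          (conf (at_action q x k.+1 false) w (upd h t 0%R)).
Proof.
move=> ka ht iw; apply: reach_step.
rewrite (action_step ka) /= after_move ht /= {ht}.
elim: i iw => [|i IHi] iw.
  apply: reach1; rewrite (action_step ka) /=.
  have r0 : reads w (upd h t (Posz 0 - 1)%R) t = None by rewrite readsE upd_same.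
  by rewrite r0 /= -{1}r0 after_move upd_same upd_upd.
apply: reach_step; rewrite (action_step ka) /=.
have := erefl (reads w (upd h t (Posz i.+1 - 1)%R) t).
rewrite {2}readsE upd_same (_ : (Posz i.+1 - 1)%R = Posz i) /=; last by lia.
rewrite iw => ri; rewrite ri /= -ri after_move upd_same upd_upd /=.
by apply: IHi; apply: ltnW.
Qed.

(** Erasing from the right leaves the tape of a prefix after every step, whence the induction on the
    last symbol. *)
Lemma reach_erase q x k t w (h : 'I_5 -> int) :
  ohead (drop k (actions q x)) = Some (Rewind t true) -> h t = size (w t) ->
  reach (size (w t)).+2 (conf (at_action q x k false) w h)
          (conf (at_action q x k.+1 false) (upd w t [::]) (upd h t 0%R)).
Proof.
move=> ka ht; apply: reach_step.
rewrite (action_step ka) /= after_move ht /= {ht}.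
rewrite -[X in conf _ X _](upd_id w t); move: (w t) => s.
elim/last_ind: s => [|s b IHs].
  apply: reach1; rewrite (action_step ka) /=.
  set w' := upd w t [::]; set h' := upd h t _.
  have r0 : reads w' h' t = None by rewrite readsE /w' /h' !upd_same.
  by rewrite r0 /= -{1}r0 after_move /h' upd_same upd_upd.
rewrite size_rcons; apply: reach_step; rewrite (action_step ka) /=.
set w' := upd w t _; set h' := upd h t _.
have ht : h' t = Posz (size s) by rewrite /h' upd_same; lia.
have -> : reads w' h' t = Some (inl b).
  by rewrite readsE ht /w' upd_same /= size_rcons leqnn nth_rcons ltnn eqxx.
rewrite /= (@after_edit _ _ _ _ _ _ s) => [|z]; last by rewrite ht /w' upd_same tape_erase.
by rewrite ht /w' /h' !upd_upd.
Qed.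

Lemma upd_comm (A : Type) (f : 'I_5 -> A) t u v1 v2 :
  t != u -> upd (upd f t v1) u v2 = upd (upd f u v2) t v1.
Proof.
move=> tu; apply: functional_extensionality => i; rewrite /upd.
by case: (i =P u) => [->|//]; rewrite eq_sym (negbTE tu).
Qed.

Lemma reach_copy q x k t u w (h : 'I_5 -> int) :
  ohead (drop k (actions q x)) = Some (Copy t u) -> t != u ->
  h t = size (w t) -> h u = 0%R ->
  reach (size (w u)).+1 (conf (at_action q x k false) w h)
    (conf (at_action q x k.+1 false) (upd w t (w t ++ w u))
          (upd (upd h t (Posz (size (w t ++ w u)))) u (Posz (size (w u))))).
Proof.
move=> ka tu ht hu.
(* Invariant: [i] symbols are copied and [n] remain. The phase is arbitrary because [Copy] starts in
   one phase, continues in the other and acts alike in both. *)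
suff copy n i phase : i + n = size (w u) ->
  reach n.+1 (conf (at_action q x k phase) (upd w t (w t ++ take i (w u)))
       (upd (upd h t (Posz (size (w t) + i))) u (Posz i)))
    (conf (at_action q x k.+1 false) (upd w t (w t ++ w u))
          (upd (upd h t (Posz (size (w t ++ w u)))) u (Posz (size (w u))))).
  have := copy (size (w u)) 0 false (add0n _).
  by rewrite take0 cats0 upd_id addn0 -ht upd_id -[Posz 0]hu upd_id.
elim: n i phase => [|n IHn] i phase; first rewrite addn0.
  move=> ->; apply: reach1; rewrite (action_step ka) /=.
  set w' := upd w t _; set h' := upd _ u _.
  have -> : reads w' h' u = None.
    by rewrite readsE /w' /h' upd_same {1}/upd eq_sym (negbTE tu) tape_size.
  by rewrite /= after_keep /w' /h' take_size size_cat.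
move=> iw; have lt_iw : i < size (w u) by rewrite -iw; lia.
apply: reach_step; rewrite (action_step ka) /=.
set w' := upd w t _; set h' := upd _ u _.
have wu : w' u = w u by rewrite /w' /upd eq_sym (negbTE tu).
have hu' : h' u = Posz i by rewrite /h' upd_same.
have ht' : h' t = Posz (size (w t) + i) by rewrite /h' /upd (negbTE tu) eqxx.
have ru : reads w' h' u = Some (inl (nth false (w u) i)).
  by rewrite readsE wu hu' /= lt_iw.
rewrite ru /= {}/after.
have := IHn i.+1 true; rewrite addSnnS => /(_ iw); congr (reach _ _ _).
congr (@Config compiled); apply: functional_extensionality => j.
  rewrite ffunE /h' /upd; case: (j =P u) => [->|ju] /=; first by rewrite orbT /=; lia.
  by rewrite orbF; case: (j =P t) => /= _; lia.
apply: functional_extensionality => z; rewrite !ffunE.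
case: (j =P t) => [->|jt] /=.
  rewrite upd_same ht' (take_nth false) // -rcons_cat -tape_rcons.
  by rewrite size_cat size_take lt_iw /w' upd_same.
have wj : forall v, upd w t v j = w j by move=> v; rewrite /upd (introF eqP jt).
rewrite wj {1}/w' wj; case: (j =P u) => [ju|_] /=.
  by rewrite ju hu' ?wu; case: eqP => [->|] //=; rewrite lt_iw.
by rewrite /w' wj; case: eqP => [->|].
Qed.

(** * Stores on tapes, and running lists of instructions *)

Definition regs (s : bits) (r : store) : 'I_5 -> bits :=
  fun t => nth [::] [:: s; stream1 r; stream2 r; nseq (counter1 r) true;
                     nseq (counter2 r) true] t.

(** The empty string stands in for the input, which has no influence on tapes other than 0. *)
Definition heads (i : nat) (r : store) : 'I_5 -> int :=
  fun t => if t == ord0 then Posz i else Posz (size (regs [::] r t)).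

Lemma tape_ind (P : 'I_5 -> Prop) :
  P ord0 -> (forall s, P (stream_tape s)) -> (forall c, P (counter_tape c)) ->
  forall t, P t.
Proof.
move=> P0 Ps Pc [[|[|[|[|[|//]]]]] lt_i5].
- by rewrite (_ : Ordinal lt_i5 = ord0) //; apply: val_inj.
- by rewrite (_ : Ordinal lt_i5 = stream_tape false) //; apply: val_inj.
- by rewrite (_ : Ordinal lt_i5 = stream_tape true) //; apply: val_inj.
- by rewrite (_ : Ordinal lt_i5 = counter_tape false) //; apply: val_inj.
- by rewrite (_ : Ordinal lt_i5 = counter_tape true) //; apply: val_inj.
Qed.

Lemma regs_stream s r b : regs s r (stream_tape b) = if b then stream2 r else stream1 r.
Proof. by case: b. Qed.

Lemma regs_counter s r c : regs s r (counter_tape c) = nseq (counter r c) true.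
Proof. by case: c. Qed.

Lemma stream_neq_counter b c : stream_tape b != counter_tape c.
Proof. by case: b c => [] []. Qed.

Lemma add_stream_regs s r b u :
  upd (regs s r) (stream_tape b) (regs s r (stream_tape b) ++ u) = regs s (add_stream r b u).
Proof.
apply: functional_extensionality; elim/tape_ind => [|s'|c]; case: r => *.
- by case: b.
- by case: b s' => [] [].
- by case: b c => [] [].
Qed.

Lemma heads_upd pos r r' t :
  (forall t', t' != t -> size (regs [::] r t') = size (regs [::] r' t')) -> t != ord0 ->
  upd (heads pos r) t (Posz (size (regs [::] r' t))) = heads pos r'.
Proof.
move=> rr' t0; apply: functional_extensionality => t'; rewrite /upd /heads.
by have [->|/rr' ->] := eqVneq t' t; rewrite ?(negbTE t0).
Qed.

Lemma regs_nil s r t : t != ord0 -> regs s r t = regs [::] r t.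
Proof. by elim/tape_ind: t => [|b|c] // _; [rewrite !regs_stream|rewrite !regs_counter]. Qed.

Lemma stream_neq0 b : stream_tape b != ord0. Proof. by case: b. Qed.
Lemma counter_neq0 c : counter_tape c != ord0. Proof. by case: c. Qed.

Lemma add_stream_heads s pos r b u :
  upd (heads pos r) (stream_tape b) (Posz (size (regs s r (stream_tape b) ++ u))) =
  heads pos (add_stream r b u).
Proof.
rewrite (regs_nil s r (stream_neq0 b)) -[X in size X](upd_same (regs [::] r) (stream_tape b)).
rewrite add_stream_regs heads_upd ?stream_neq0 // => t tb.
by rewrite -add_stream_regs /upd (negbTE tb).
Qed.

Lemma heads_size s pos r t : t != ord0 -> heads pos r t = Posz (size (regs s r t)).
Proof. by move=> t0; rewrite /heads (negbTE t0) (regs_nil s). Qed.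

Lemma incr_regs s r c :
  regs s (exec r (Incr c)) =
  upd (regs s r) (counter_tape c) (rcons (regs s r (counter_tape c)) true).
Proof.
apply: functional_extensionality; elim/tape_ind => [|b|c']; case: r => a b' p j.
- by case: c.
- by case: c b => [] [].
- by case: c c' => [] [] //; rewrite /upd /= -cats1 -(nseqD _ 1) addn1.
Qed.

Local Arguments add_stream : simpl never.

(** The costliest instruction is [EmitCounter]: for a counter [c], [c + 2] steps to rewind and
    [c + 1] to copy. *)
Lemma reach_instr q x s pos k i rest r B :
  drop k (actions q x) = compile i ++ rest -> (forall c, counter r c <= B) ->
  reach (2 * B + 3) (conf (at_action q x k false) (regs s r) (heads pos r))
    (conf (at_action q x (k + size (compile i)) false) (regs s (exec r i))
          (heads pos (exec r i))).
Proof.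
case: i => [b u|b c|c] /= dk rB.
- apply: (@reach_leq 1); first lia.
  rewrite addn1 -add_stream_regs -(add_stream_heads s) cats1 size_rcons.
  apply: reach_push; first by rewrite dk.
  by rewrite (heads_size s) ?stream_neq0.
- apply: (@reach_leq ((counter r c).+2 + (counter r c).+1)); first by have := rB c; lia.
  have szc : size (regs s r (counter_tape c)) = counter r c by rewrite regs_counter size_nseq.
  apply: reach_trans.
    apply: reach_rewind; [by rewrite dk| |by rewrite szc].
    by rewrite (heads_size s) ?counter_neq0 // szc.
  rewrite addn2 -{1}szc; set h := upd _ _ _.
  have -> : heads pos (add_stream r b (nseq (counter r c) true)) =
      upd (upd h (stream_tape b)
           (Posz (size (regs s r (stream_tape b) ++ regs s r (counter_tape c)))))
        (counter_tape c) (Posz (size (regs s r (counter_tape c)))).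
    rewrite /h upd_comm ?stream_neq_counter // upd_upd -(heads_size s pos) ?counter_neq0 //.
    by rewrite upd_id -(regs_counter s) -(add_stream_heads s).
  rewrite -(regs_counter s) -add_stream_regs.
  apply: reach_copy.
  + by rewrite -add1n -drop_drop dk.
  + exact: stream_neq_counter.
  + rewrite /h /upd (negbTE (stream_neq_counter _ _)) -(heads_size s pos) //.
    exact: stream_neq0.
  + by rewrite /h upd_same.
apply: (@reach_leq 1); first lia.
rewrite addn1.
pose r' := exec r (Incr c); have rE : regs s r' = _ := incr_regs s r c.
rewrite -[X in reach _ _ X]/(conf (at_action q x k.+1 false) (regs s r') (heads pos r')).
have -> : heads pos r' = upd (heads pos r) (counter_tape c)
     (Posz (size (regs s r (counter_tape c))).+1).
  rewrite -(size_rcons _ true) -(@heads_upd pos r r' (counter_tape c)) ?counter_neq0 //.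
    by rewrite -(regs_nil s) ?counter_neq0 // rE upd_same.
  move=> t tc; have [->//|t0] := eqVneq t ord0.
  by rewrite -!(regs_nil s) // rE /upd (negbTE tc).
rewrite rE; apply: reach_push; first by rewrite dk.
by rewrite (heads_size s) ?counter_neq0.
Qed.

Lemma reach_instrs q x s pos l k rest r B :
  drop k (actions q x) = flatten [seq compile i | i <- l] ++ rest ->
  (forall c, counter r c + size l <= B) ->
  reach (size l * (2 * B + 3)) (conf (at_action q x k false) (regs s r) (heads pos r))
    (conf (at_action q x (k + size (flatten [seq compile i | i <- l])) false)
          (regs s (foldl exec r l)) (heads pos (foldl exec r l))).
Proof.
elim: l k r => [|i l IHl] k r; first by rewrite /= addn0 => _ _; exists 0.
rewrite [flatten _]/= -catA => dk rB; rewrite [size (i :: l)]/= mulSn.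
apply: reach_trans; first by apply: (reach_instr _ _ dk) => c; move: (rB c) => /=; lia.
rewrite size_cat addnA; apply: IHl; first by rewrite addnC -drop_drop dk drop_size_cat.
have [|rc _ _] := @exec_bounds B [:: i] r; first by move=> c; move: (rB c) => /=; lia.
by move=> c; move: (rc c) (rB c) => /=; lia.
Qed.

(** * Running on a whole input *)

Lemma reach_bit q s pos r B :
  pos < size s -> (forall c, counter r c + max_actions <= B) ->
  let qr := tr_step (q, r) (nth false s pos) in
  reach (max_actions * (2 * B + 3) + 2) (conf (Some (q, None)) (regs s r) (heads pos r))
    (conf (Some (qr.1, None)) (regs s qr.2) (heads pos.+1 qr.2)).
Proof.
move=> lt_pos rB; rewrite /tr_step /=; set b := nth _ _ _; set l := (tr_delta q b).1.
(* The two extra steps read the bit and leave the exhausted list of actions. *)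
rewrite addn2; apply: reach_step; rewrite conf_step //=.
have r0 : reads (regs s r) (heads pos r) ord0 = Some (inl b) by rewrite readsE /= lt_pos.
rewrite r0 -r0 after_move.
have -> : upd (heads pos r) ord0 (move Right (heads pos r ord0)) = heads pos.+1 r.
  by apply: functional_extensionality => t; rewrite /upd /heads; case: eqP => //= _; lia.
have szl := size_instrs q b.
rewrite -addn1; apply: reach_trans.
  apply: (@reach_leq (size l * (2 * B + 3))); first by rewrite leq_mul2r szl orbT.
  apply: (@reach_instrs _ _ _ _ l _ [::]); first by rewrite drop0 cats0.
  by move=> c; apply: leq_trans (rB c); rewrite leq_add2l.
apply: reach1; rewrite add0n conf_step //= inordK; last exact: (size_actions q (Some b)).
by rewrite drop_size /= after_keep.
Qed.

(** The bound [B] is fixed in advance for the rest of the input: a bit triggers at most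
    [max_actions] increments of a counter. *)
Lemma reach_run s2 : forall q s pos r B,
  drop pos s = s2 -> (forall c, counter r c + max_actions * size s2 <= B) ->
  let qr := foldl (@tr_step T) (q, r) s2 in
  [/\ reach (size s2 * (max_actions * (2 * B + 3) + 2))
        (conf (Some (q, None)) (regs s r) (heads pos r))
        (conf (Some (qr.1, None)) (regs s qr.2) (heads (pos + size s2) qr.2)),
      size (stream1 qr.2) <= size (stream1 r) + size s2 * (max_actions * B.+1)
    & size (stream2 qr.2) <= size (stream2 r) + size s2 * (max_actions * B.+1)].
Proof.
elim: s2 => [|b s2 IHs] q s pos r B ds rB.
  by split; rewrite ?mul0n ?addn0 //; exists 0.
have lt_pos : pos < size s by rewrite ltnNge; apply/negP => /drop_oversize; rewrite ds.
have [nth_b ds'] : nth false s pos = b /\ drop pos.+1 s = s2.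
  by move: ds; rewrite (drop_nth false lt_pos) => -[].
have rB0 c : counter r c + max_actions <= B.
  by have := rB c; rewrite /= mulnS; lia.
have bit := reach_bit q lt_pos rB0; rewrite nth_b in bit.
rewrite [foldl _ _ _]/=; move: bit.
case E : (tr_step (q, r) b) => [q' r'] bit.
have [|rc st1 st2] := @exec_bounds B (tr_delta q b).1 r.
  by move=> c; apply: leq_trans (rB0 c); rewrite leq_add2l size_instrs.
have szl := size_instrs q b.
have szB : size (tr_delta q b).1 * B.+1 <= max_actions * B.+1 by rewrite leq_mul2r szl orbT.
move: rc st1 st2; have -> : foldl exec r (tr_delta q b).1 = r' by case: E.
move=> rc st1 st2.
have [|run le1 le2] := IHs q' s pos.+1 r' B ds'.
  by move=> c; move: (rB c) (rc c); rewrite /= mulnS; lia.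
split.
- by rewrite [size _]/= mulSn -[pos + _]addSnnS; apply: reach_trans bit run.
- by apply: leq_trans le1 _; rewrite /= mulSn; lia.
- by apply: leq_trans le2 _; rewrite /= mulSn; lia.
Qed.

Lemma reach_final q s r :
  let a := size (stream1 r) in let b := size (stream2 r) in
  exists h, h ord0 = 0%R /\ exists w, w ord0 = stream1 r ++ stream2 r /\
  reach (size s + 3 * a + 3 * b + 12)
    (conf (Some (q, None)) (regs s r) (heads (size s) r)) (conf None w h).
Proof.
move=> a b; set o := stream1 r ++ stream2 r.
pose w1 := upd (regs s r) ord0 [::]; pose h1 := upd (heads (size s) r) ord0 0%R.
pose st1 := stream_tape false; pose st2 := stream_tape true.
pose h2 := upd h1 st1 0%R.
pose w3 := upd w1 ord0 (stream1 r).
pose h3 := upd (upd h2 ord0 (Posz a)) st1 (Posz a).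
pose h4 := upd h3 st2 0%R.
pose w5 := upd w3 ord0 o.
pose h5 := upd (upd h4 ord0 (Posz (size o))) st2 (Posz b).
exists (upd h5 ord0 0%R); split; first by rewrite upd_same.
exists w5; split; first by rewrite /w5 upd_same.
(* One step notices the end of the input, the six middle terms are the costs of [final_actions], and
   one step halts. *)
apply: (@reach_leq (1 + (size s).+2 + a.+2 + a.+1 + b.+2 + b.+1 + (size o).+2 + 1)).
  by rewrite /o size_cat -/a -/b; lia.
apply: (reach_trans (c2 := conf (at_action q None 6 false) w5 (upd h5 ord0 0%R))); last first.
  apply: reach1; rewrite conf_step //= inordK; last exact: (size_actions q None).
  by rewrite after_keep.
apply: (reach_trans (c2 := conf (at_action q None 5 false) w5 h5)); last first.
  apply: reach_rewind => //; by rewrite /w5 upd_same.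
apply: (reach_trans (c2 := conf (at_action q None 4 false) w3 h4)); last first.
  have := @reach_copy q None 4 ord0 st2 w3 h4 erefl isT.
  rewrite (_ : w3 st2 = stream2 r) // (_ : w3 ord0 = stream1 r) //; apply=> //.
apply: (reach_trans (c2 := conf (at_action q None 3 false) w3 h3)); last first.
  exact: (@reach_rewind q None 3 st2 w3 h3 b).
apply: (reach_trans (c2 := conf (at_action q None 2 false) w1 h2)); last first.
  have := @reach_copy q None 2 ord0 st1 w1 h2 erefl isT.
  rewrite (_ : w1 st1 = stream1 r) // (_ : w1 ord0 = [::]) //; apply=> //.
apply: (reach_trans (c2 := conf (at_action q None 1 false) w1 h1)); last first.
  exact: (@reach_rewind q None 1 st1 w1 h1 a).
apply: (reach_trans (c2 := conf (at_action q None 0 false) (regs s r) (heads (size s) r))).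
  apply: reach1; rewrite conf_step //= readsE /= ltnn; exact: after_keep.
exact: (@reach_erase q None 0 ord0 (regs s r) (heads (size s) r)).
Qed.

Lemma polytime_transduce : polytime1 (transduce T).
Proof.
(* For inputs of length [n], [B n] bounds the counters, [S n] each stream and [t n] the running
   time. *)
pose B n := max_actions * n.
pose S n := n * (max_actions * (B n).+1).
pose t n := n * (max_actions * (2 * B n + 3) + 2) + (n + 3 * S n + 3 * S n + 12).
have [a [d tE]] : poly_bounded t.
  rewrite /t /S /B.
  by do ![apply: poly_boundedD | apply: poly_boundedM | apply: poly_bounded_id
         | apply: poly_boundedS
         | apply: poly_bounded_const].
exists compiled, a, d => s; apply: tm_outputs_leq (tE _) _.
have [|run le1 le2] :=
  @reach_run s (tr_start T) s 0 (Store [::] [::] 0 0) (B (size s)) (drop0 s).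
  by case.
set qr := foldl _ _ _ in run le1 le2.
have [h [h0 [w [w0 fin]]]] := reach_final qr.1 s qr.2.
have [k k_le kE] := reach_trans run fin.
have init : conf (Some (tr_start T, None)) (regs s (Store [::] [::] 0 0))
    (heads 0 (Store [::] [::] 0 0)) = tm_init compiled s [::].
  congr (@Config compiled); apply: functional_extensionality;
    by elim/tape_ind => [|[]|[]].
apply: (@tm_outputs_leq _ _ _ _ k).
  by apply: leq_trans k_le _; rewrite /t /S; move: le1 le2 => /=; lia.
by rewrite /tm_outputs -init kE /= h0 w0.
Qed.

End Compile.

(** * Prefix codes *)

(** The suffixes let the property pass to concatenations, which injectivity alone would not. *)
Definition prefix_code (A : Type) (enc : A -> bits) : Prop :=
  forall u v s t, enc u ++ s = enc v ++ t -> u = v /\ s = t.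

Lemma prefix_code_nat : prefix_code enc_nat.
Proof.
rewrite /enc_nat; elim=> [|u IHu] [|v] s t //=; first by case.
by case=> /IHu[-> ->].
Qed.

Lemma prefix_code_bit : prefix_code (fun b : bool => [:: b]).
Proof. by move=> u v s t [-> ->]. Qed.

Lemma enc_seq_cons (A : Type) (enc : A -> bits) (u : A) (us : seq A) :
  enc_seq enc (u :: us) = true :: enc u ++ enc_seq enc us.
Proof. by rewrite /enc_seq /= rcons_cat. Qed.

Lemma enc_seq_cat (A : Type) (enc : A -> bits) (us vs : seq A) :
  enc_seq enc (us ++ vs) = flatten [seq true :: enc u | u <- us] ++ enc_seq enc vs.
Proof. by rewrite /enc_seq map_cat flatten_cat rcons_cat. Qed.

Lemma prefix_code_seq (A : Type) (enc : A -> bits) :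
  prefix_code enc -> prefix_code (enc_seq enc).
Proof.
move=> encP; elim=> [|u us IHu] [|v vs] s t; rewrite ?enc_seq_cons //=; first by case.
by rewrite -!catA => -[/encP[-> /IHu[-> ->]]].
Qed.

Lemma prefix_code_gate : prefix_code enc_gate.
Proof.
have natP := prefix_code_nat.
move=> [i|b|i|i j|i j] [i'|b'|i'|i' j'|i' j'] s t //=; rewrite -?catA.
- by case=> /natP[-> ->].
- by case=> -> ->.
- by case=> /natP[-> ->].
- by case=> /natP[-> /natP[-> ->]].
- by case=> /natP[-> /natP[-> ->]].
Qed.

Lemma prefix_code_circuit : prefix_code enc_circuit.
Proof.
move=> [g o] [g' o'] s t; rewrite /enc_circuit /= -!catA.
by move=> /(prefix_code_seq prefix_code_gate)[-> /(prefix_code_seq prefix_code_nat)[-> ->]].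
Qed.

(** A solution refers to some instance with the given encoding; injectivity identifies that instance
    with the categorized one. *)
Lemma catpigeon_enc_inj : injective catpigeon_enc.
Proof.
have natP := prefix_code_nat; have circP := prefix_code_circuit.
have seqP := prefix_code_seq (prefix_code_seq prefix_code_bit).
move=> [m1 m2 p h Pi] [m1' m2' p' h' Pi'] /=; rewrite /catpigeon_enc /=.
move=> /natP[-> /natP[-> /circP[-> /circP[-> eqPi]]]].
by have [->] := seqP Pi Pi' [::] [::] (congr1 (cat^~ [::]) eqPi).
Qed.

(** * The categorized instance *)

(** Inputs move by one because of the new first bit, gates by two because that bit and its negation
    are computed first. *)
Definition shift_gate (g : gate) : gate :=
  match g with
  | GInput i => GInput i.+1
  | GConst b => GConst b
  | GNot i => GNot i.+2
  | GAnd i j => GAnd i.+2 j.+2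
  | GOr i j => GOr i.+2 j.+2
  end.

(* Gates at positions [k], ..., [k + 3]; gates 0 and 1 hold the first input bit
   and its negation, and gate [o] of the original circuit is now at [o + 2]. *)
Definition mux (k j o : nat) : seq gate :=
  [:: GInput j.+1; GAnd 0 o.+2; GAnd 1 k; GOr k.+1 k.+2].

Fixpoint muxes (k j : nat) (os : seq nat) : seq gate :=
  if os is o :: os' then mux k j o ++ muxes k.+4 j.+1 os' else [::].

Fixpoint mux_outputs (k : nat) (os : seq nat) : seq nat :=
  if os is _ :: os' then k.+3 :: mux_outputs k.+4 os' else [::].

Definition head_circuit : circuit := Circuit [:: GInput 0] [:: 0].

Definition mux_circuit (c : circuit) : circuit :=
  Circuit ([:: GInput 0; GNot 0] ++ [seq shift_gate g | g <- gates c]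
             ++ muxes (size (gates c)).+2 0 (outputs c))
          (mux_outputs (size (gates c)).+2 (outputs c)).

Definition categorize (a : pigeon_data) : catpigeon_data :=
  CatPigeonData 1 (pg_n a) head_circuit (mux_circuit (pg_f a)) [:: false :: pg_v a].

(** [gate_vals] from arbitrary initial values, to evaluate a circuit block by block. *)
Definition extend_vals (x vals : bits) (gs : seq gate) : bits :=
  foldl (fun vals g => rcons vals (gate_val x vals g)) vals gs.

Lemma extend_vals_cat x vals gs1 gs2 :
  extend_vals x vals (gs1 ++ gs2) = extend_vals x (extend_vals x vals gs1) gs2.
Proof. exact: foldl_cat. Qed.

Lemma size_extend_vals x vals gs : size (extend_vals x vals gs) = size vals + size gs.
Proof.
elim: gs vals => [|g gs IHgs] vals /=; first by rewrite addn0.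
by rewrite IHgs size_rcons addSnnS.
Qed.

Lemma extend_vals_shift b x vals gs :
  extend_vals (b :: x) [:: b, ~~ b & vals] [seq shift_gate g | g <- gs] =
  [:: b, ~~ b & extend_vals x vals gs].
Proof. by elim: gs vals => //= g gs IHgs vals; rewrite -IHgs; case: g. Qed.

(** [V] holds the values of the original gates, [E] those of the multiplexers already evaluated,
    [E'] those to come; letting [E] grow carries the induction, since every multiplexer still refers
    into [V]. *)
Lemma extend_vals_muxes (b : bool) (x V : bits) (os : seq nat) :
  all (fun o => o < size V) os ->
  forall (E : bits) (k j : nat),
    k = (size V + size E).+2 -> j + size os <= size x ->
    exists E', extend_vals (b :: x) [:: b, ~~ b & V ++ E] (muxes k j os) =
        [:: b, ~~ b & V ++ E ++ E'] /\
      [seq nth false [:: b, ~~ b & V ++ E ++ E'] i | i <- mux_outputs k os] =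
      if b then [seq nth false V o | o <- os] else take (size os) (drop j x).
Proof.
elim: os => [|o os IHos].
  by move=> _ E k j _ _; exists [::]; rewrite /= take0 !cats0 if_same.
move=> /andP[oV osV] E k j kE jx; rewrite [size _]/= in jx.
have lt_jx : j < size x by lia.
(* These are the values of the four gates of [mux], in order. *)
pose m0 := nth false x j; pose m1 := b && nth false V o; pose m2 := ~~ b && m0.
pose M := [:: m0; m1; m2; m1 || m2].
have [||E' [IHe IHo]] := IHos osV (E ++ M) k.+4 j.+1.
- by rewrite kE size_cat /=; lia.
- by lia.
have oVE : o < size (V ++ E) by rewrite size_cat; lia.
have kVE : k = (size (V ++ E)).+2 by rewrite size_cat.
have muxE : extend_vals (b :: x) [:: b, ~~ b & V ++ E] (mux k j o) =
    [:: b, ~~ b & V ++ E ++ M].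
  rewrite kVE catA /extend_vals /= !nth_rcons !size_rcons oVE ltnS leqnn.
  rewrite !ltnn !eqxx nth_cat oV !(ltn_eqF, ltnn, leqnn) //=.
  by rewrite -!cats1 -!catA.
exists (M ++ E'); split.
  rewrite -[muxes k j (o :: os)]/(mux k j o ++ muxes k.+4 j.+1 os) extend_vals_cat.
  by rewrite muxE IHe -!catA.
rewrite [mux_outputs _ _]/= [map _ (_ :: _)]/=.
have -> : V ++ E ++ M ++ E' = V ++ (E ++ M) ++ E' by rewrite -!catA.
(* Past the two leading values, output [k.+3] has index [k.+1], which is three places into [M]. *)
have -> : nth false (V ++ (E ++ M) ++ E') k.+1 = m1 || m2.
  rewrite kVE /= -(catA E) catA nth_cat ltnNge -addn3 leq_addr /=.
  by rewrite addnC addnK.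
rewrite /= IHo /m1 /m2 /m0; case: (b) => /=; first by rewrite orbF.
by rewrite (drop_nth false lt_jx).
Qed.

(** The gate condition of [circuit_wf] with the first position as a parameter, so that it splits
    along concatenations. *)
Definition gates_wf (n k : nat) (gs : seq gate) : bool :=
  all (fun tg => gate_wf n tg.1 tg.2) (zip (iota k (size gs)) gs).

Lemma gates_wfE (n k : nat) (gs : seq gate) :
  gates_wf n k gs =
  all (fun t => gate_wf n t (nth (GConst false) gs (t - k))) (iota k (size gs)).
Proof.
rewrite /gates_wf; elim: gs k => //= g gs IHgs k; rewrite subnn IHgs; congr (_ && _).
apply: eq_in_all => t; rewrite mem_iota => /andP[kt _].
by rewrite -(@subnSK k t).
Qed.

Lemma circuit_wfE (n m : nat) (c : circuit) :
  circuit_wf n m c = [&& gates_wf n 0 (gates c),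
    all (fun j => j < size (gates c)) (outputs c) & size (outputs c) == m].
Proof. by rewrite gates_wfE; congr (_ && _); apply: eq_all => t; rewrite subn0. Qed.

Lemma gates_wf_cat (n k : nat) (gs1 gs2 : seq gate) :
  gates_wf n k (gs1 ++ gs2) = gates_wf n k gs1 && gates_wf n (k + size gs1) gs2.
Proof. by rewrite /gates_wf size_cat iotaD zip_cat ?size_iota // all_cat. Qed.

Lemma gates_wf_shift (n k : nat) (gs : seq gate) :
  gates_wf n k gs -> gates_wf n.+1 k.+2 [seq shift_gate g | g <- gs].
Proof.
elim: gs k => //= g gs IHgs k /andP[wfg wfgs]; apply/andP; split; last exact: IHgs wfgs.
by case: g wfg.
Qed.

Lemma gates_wf_muxes (n s k j : nat) (os : seq nat) :
  all (fun o => o < s) os -> s.+2 <= k -> j + size os <= n ->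
  gates_wf n.+1 k (muxes k j os).
Proof.
elim: os k j => //= o os IHos k j /andP[os_lt oss] sk jn.
rewrite -[_ :: _ :: _ :: _ :: muxes _ _ _]/(mux k j o ++ _) gates_wf_cat.
apply/andP; split; first by rewrite /gates_wf /= /gate_wf /=; lia.
by rewrite addn4; apply: IHos => //; lia.
Qed.

Lemma mux_outputs_lt (k : nat) (os : seq nat) :
  all (fun i => i < k + 4 * size os) (mux_outputs k os).
Proof.
elim: os k => //= _ os IHos k; apply/andP; split; first by lia.
by apply: sub_all (IHos k.+4) => i; lia.
Qed.

Lemma size_muxes (k j : nat) (os : seq nat) : size (muxes k j os) = 4 * size os.
Proof. by elim: os k j => //= o os IHos k j; rewrite IHos; lia. Qed.

Lemma size_mux_outputs (k : nat) (os : seq nat) : size (mux_outputs k os) = size os.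
Proof. by elim: os k => //= o os IHos k; rewrite IHos. Qed.

Lemma categorize_valid (a : pigeon_data) :
  pigeon_valid a -> catpigeon_valid (categorize a).
Proof.
rewrite /pigeon_valid circuit_wfE => -[/and3P[wfg wfo /eqP szo] szv].
split=> //; last by rewrite /= szv eqxx.
rewrite circuit_wfE; apply/and3P; split; last by rewrite size_mux_outputs szo.
  rewrite /categorize /mux_circuit; cbn [cp_m1 cp_m2 cp_h gates].
  rewrite !gates_wf_cat; apply/and3P; split=> //.
    exact: gates_wf_shift.
  rewrite size_map.
  by apply: (@gates_wf_muxes _ (size (gates (pg_f a))) (size (gates (pg_f a))).+2);
    rewrite ?szo.
apply: sub_all (mux_outputs_lt _ _) => i.
by rewrite /= size_cat size_map size_muxes; lia.
Qed.

Lemma eval_mux_circuit (n : nat) (c : circuit) (b : bool) (x : bits) :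
  circuit_wf n n c -> size x = n ->
  eval (mux_circuit c) (b :: x) = if b then eval c x else x.
Proof.
move=> /and3P[_ wfo /eqP szo] szx; rewrite /eval /gate_vals /=.
rewrite -/(extend_vals _ _ _) extend_vals_cat extend_vals_shift.
set V := extend_vals x [::] (gates c).
have szV : size V = size (gates c) by rewrite size_extend_vals.
have [|||E' [valE mapE]] := @extend_vals_muxes b x V (outputs c) _ [::] (size (gates c)).+2 0.
- by rewrite szV.
- by rewrite szV addn0.
- by rewrite szo szx.
rewrite cats0 in valE.
by rewrite valE mapE drop0 szo -szx take_size.
Qed.

Definition strip_witness (w : witness) : witness :=
  match w with
  | One x => One (behead x)
  | Two x y => Two (behead x) (behead y)
  end.

Lemma categorize_solved (a : pigeon_data) (w : witness) :
  pigeon_valid a -> catpigeon_solves (categorize a) w ->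
  pigeon_solves a (strip_witness w).
Proof.
move=> [wf szv]; case: w => [[|b x]|[|b x] [|c y]] //=.
- by case=> -[].
- rewrite /remaining /= => -[[[szx] xv]].
  rewrite !(eval_mux_circuit _ wf) // inE => /eqP; rewrite inE in xv.
  by case: b xv => // /eqP xv xE; case: xv; rewrite xE.
- by case=> -[].
- by case=> -[].
- by case=> _ [].
rewrite /remaining /= => -[[[szx] xv] [[szy] yv] xy].
(* Equality under [head_circuit] makes the first bits agree. *)
rewrite !(eval_mux_circuit _ wf) // => -[bc]; rewrite -{c}bc in yv xy *.
case: b xv yv xy => _ _ xy hE; last by case: xy; rewrite hE.
by split=> // xyE; case: xy; rewrite xyE.
Qed.

(** * The reduction as a transducer *)

Definition puts (s : bool) (u : bits) : seq instr := [seq Emit s x | x <- u].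

Lemma exec_puts s u r : foldl exec r (puts s u) = add_stream r s u.
Proof.
elim: u r => [|x u IHu] r /=; first by case: r s => a b p j []; rewrite /= cats0.
by rewrite IHu {IHu}; case: r s => a b p j []; rewrite /= -catA.
Qed.

(* [RTag k] has read [k] ones of the tag of a gate; [RNum2] and [RNum1] are
   reading the last two numbers, resp. the last number, of a gate. *)
Inductive red_state :=
  | RStart | RWidth | RGate | RTag of 'I_5 | RNum2 | RNum1 | RConst
  | ROut | RRef | RTarget | RBit | REnd.

Definition red_state_code (q : red_state) : 'I_11 + 'I_5 :=
  match q with
  | RTag k => inr k
  | RStart => inl (inord 0) | RWidth => inl (inord 1) | RGate => inl (inord 2)
  | RNum2 => inl (inord 3) | RNum1 => inl (inord 4) | RConst => inl (inord 5)
  | ROut => inl (inord 6) | RRef => inl (inord 7) | RTarget => inl (inord 8)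
  | RBit => inl (inord 9) | REnd => inl (inord 10)
  end.

Definition red_state_decode (i : 'I_11 + 'I_5) : red_state :=
  match i with
  | inr k => RTag k
  | inl i => nth RStart [:: RStart; RWidth; RGate; RNum2; RNum1; RConst; ROut; RRef;
                            RTarget; RBit; REnd] i
  end.

Lemma red_state_codeK : cancel red_state_code red_state_decode.
Proof. by case=> //=; rewrite inordK. Qed.

HB.instance Definition _ := Finite.copy red_state (can_type red_state_codeK).

(** The [false] closes the tag; the ones after it begin the next number and so perform the shift of
    [shift_gate], by one for an input and by two for a gate. Tags 3 and 4 share a format. *)
Definition tag_end (k : nat) : bits * red_state :=
  match k with
  | 0 => ([:: false; true], RNum1)
  | 1 => ([:: false], RConst)
  | 2 => ([:: false; true; true], RNum1)
  | _ => ([:: false; true; true], RNum2)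
  end.

(** The fixed text between [m2] and the shifted gates; the gate list of the second circuit stays
    open. *)
Definition header : bits :=
  enc_circuit head_circuit ++
  flatten [seq true :: enc_gate g | g <- [:: GInput 0; GNot 0]].

(* Stream 1 receives everything up to the gates of the multiplexed circuit, and
   stream 2 its outputs and the removed string; counter 1 is the number of gates
   written so far, and counter 2 the number of outputs read so far. *)
Definition red_delta (q : red_state) (x : bool) : seq instr * red_state :=
  match q, x with
  | RStart, true =>
    (Incr false :: Incr false :: puts false (enc_nat 1 ++ [:: true]), RWidth)
  | RStart, false =>
    (Incr false :: Incr false :: puts false (enc_nat 1 ++ false :: header), RGate)
  | RWidth, true => (puts false [:: true], RWidth)
  | RWidth, false => (puts false (false :: header), RGate)
  | RGate, true => (Incr false :: puts false [:: true], RTag ord0)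
  | RGate, false => ([::], ROut)
  | RTag k, true => (puts false [:: true], RTag (inord k.+1))
  | RTag k, false => (puts false (tag_end k).1, (tag_end k).2)
  | RNum2, true => (puts false [:: true], RNum2)
  | RNum2, false => (puts false [:: false; true; true], RNum1)
  | RNum1, true => (puts false [:: true], RNum1)
  | RNum1, false => (puts false [:: false], RGate)
  | RConst, _ => (puts false [:: x], RGate)
  | ROut, true =>
    (puts false (true :: enc_nat 0) ++ EmitCounter false true ::
     puts false (enc_nat 1 ++ true :: enc_nat 3 ++ enc_nat 0 ++ [:: true; true]), RRef)
  | ROut, false =>
    (puts false [:: false] ++ puts true [:: false; true; true; false], RTarget)
  | RRef, true => (puts false [:: true], RRef)
  | RRef, false =>
    (puts false (false :: true :: enc_nat 3 ++ enc_nat 1) ++ EmitCounter false false ::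
     puts false (false :: true :: enc_nat 4) ++ EmitCounter false false ::
     puts false (enc_nat 1) ++ EmitCounter false false :: puts false (enc_nat 2) ++
     puts true [:: true] ++ EmitCounter true false :: puts true (enc_nat 3) ++
     [:: Incr false; Incr false; Incr false; Incr false; Incr true], ROut)
  | RTarget, true => (puts true [:: true], RBit)
  | RTarget, false => (puts true [:: false; false], REnd)
  | RBit, _ => (puts true [:: x], RTarget)
  | REnd, _ => ([::], REnd)
  end.

Definition red_transducer : transducer := @Transducer red_state RStart red_delta.

Local Notation run := (foldl (@tr_step red_transducer)).

Lemma run_ones (q : red_state) (n : nat) a b p j :
  red_delta q true = (puts false [:: true], q) ->
  run (q, Store a b p j) (nseq n true) = (q, Store (a ++ nseq n true) b p j).
Proof.
move=> q1; elim: n a => [|n IHn] a; first by rewrite cats0.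
by rewrite /= {2}/tr_step /= q1 /= IHn -catA.
Qed.

Lemma run_unary (q q' : red_state) (u : bits) (n : nat) a b p j :
  red_delta q true = (puts false [:: true], q) ->
  red_delta q false = (puts false (false :: u), q') ->
  run (q, Store a b p j) (enc_nat n) = (q', Store (a ++ enc_nat n ++ u) b p j).
Proof.
move=> q1 q0; rewrite /enc_nat -cats1 foldl_cat run_ones //=.
by rewrite /tr_step /= q0 exec_puts /= -!catA.
Qed.

Lemma run_gate (g : gate) a b p j :
  run (RGate, Store a b p j) (true :: enc_gate g) =
  (RGate, Store (a ++ true :: enc_gate (shift_gate g)) b p.+1 j).
Proof.
have num1 n a' := @run_unary RNum1 RGate [::] n a' b p.+1 j erefl erefl.
have num2 n a' := @run_unary RNum2 RNum1 [:: true; true] n a' b p.+1 j erefl erefl.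
case: g => [i|c|i|i k|i k]; rewrite /= /tr_step /= ?inordK //= ?foldl_cat ?num2 ?num1;
  by rewrite -?catA ?cats0.
Qed.

Lemma run_gates (gs : seq gate) a b p j :
  run (RGate, Store a b p j) (enc_seq enc_gate gs) =
  (ROut, Store (a ++ flatten [seq true :: enc_gate (shift_gate g) | g <- gs])
               b (p + size gs) j).
Proof.
elim: gs a p => [|g gs IHgs] a p; first by rewrite /= cats0 addn0.
by rewrite enc_seq_cons -cat_cons foldl_cat run_gate IHgs /= addSnnS -catA.
Qed.

(** A counter followed by [enc_nat d] encodes their sum; moving ones to the front exposes this. *)
Lemma nseq_cat_cons (n : nat) (s : bits) :
  nseq n true ++ true :: s = true :: nseq n true ++ s.
Proof. by elim: n => //= n ->. Qed.

Lemma run_cons qr x s : run qr (x :: s) = run (tr_step qr x) s.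
Proof. by []. Qed.

Lemma red_step (q q' : red_state) (x : bool) (l : seq instr) (r : store) :
  red_delta q x = (l, q') -> @tr_step red_transducer (q, r) x = (q', foldl exec r l).
Proof. by rewrite /tr_step /= => ->. Qed.

Lemma exec_puts1 a b p j u : foldl exec (Store a b p j) (puts false u) = Store (a ++ u) b p j.
Proof. exact: exec_puts. Qed.

Lemma exec_puts2 a b p j u : foldl exec (Store a b p j) (puts true u) = Store a (b ++ u) p j.
Proof. exact: exec_puts. Qed.

Lemma exec_counter1 a b p j c l :
  foldl exec (Store a b p j) (EmitCounter false c :: l) =
  foldl exec (Store (a ++ nseq (if c then j else p) true) b p j) l.
Proof. by case: c. Qed.

Lemma exec_counter2 a b p j c l :
  foldl exec (Store a b p j) (EmitCounter true c :: l) =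
  foldl exec (Store a (b ++ nseq (if c then j else p) true) p j) l.
Proof. by case: c. Qed.

Definition execE := (exec_puts1, exec_puts2, exec_counter1, exec_counter2, foldl_cat).

(** The code of [o] is copied while it is read, behind two ones that turn it into [o.+2]; the other
    positions are a counter plus a constant. Four gates are written, so counter 1 rises by 4. *)
Lemma run_output (o : nat) a b p j :
  run (ROut, Store a b p j) (true :: enc_nat o) =
  (ROut, Store (a ++ flatten [seq true :: enc_gate g | g <- mux p j o])
               (b ++ true :: enc_nat p.+3) p.+4 j.+1).
Proof.
rewrite /enc_nat -cats1 -cat_cons foldl_cat.
rewrite !run_cons.
rewrite (red_step _ (erefl (red_delta ROut true))) !execE run_ones //.
rewrite (red_step _ (erefl (red_delta RRef false))) !execE.
congr (_, Store _ _ _ _).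
  by rewrite /= /enc_nat /= -!cats1 -!catA /= !nseq_cat_cons cats0.
by rewrite -!catA /= /enc_nat /= -cats1 !nseq_cat_cons.
Qed.

(** The trailing [[:: true; true; false]] opens the list of removed elements and its only entry, and
    writes the first bit of that entry. *)
Lemma run_outputs (os : seq nat) a b p j :
  run (ROut, Store a b p j) (enc_seq enc_nat os) =
  (RTarget, Store (a ++ enc_seq enc_gate (muxes p j os))
                  (b ++ enc_seq enc_nat (mux_outputs p os) ++ [:: true; true; false])
                  (p + 4 * size os) (j + size os)).
Proof.
elim: os a b p j => [|o os IHos] a b p j.
  by rewrite /= /tr_step /= -!catA !addn0.
rewrite enc_seq_cons -cat_cons foldl_cat run_output IHos.
have -> : muxes p j (o :: os) = mux p j o ++ muxes p.+4 j.+1 os by [].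
rewrite enc_seq_cat -!catA; congr (_, Store _ _ _ _).
- by rewrite [mux_outputs _ (_ :: _)]/= enc_seq_cons /= -!catA.
- by rewrite /=; lia.
- by rewrite /=; lia.
Qed.

Lemma run_target (v : bits) a b p j :
  run (RTarget, Store a b p j) (enc_bits v) =
  (REnd, Store a (b ++ enc_bits v ++ [:: false]) p j).
Proof.
rewrite /enc_bits; elim: v b => [|x v IHv] b; first by rewrite /= /tr_step /= -!catA.
by rewrite enc_seq_cons /= {2 3}/tr_step /= IHv -!catA.
Qed.

Lemma transduce_red (a : pigeon_data) :
  transduce red_transducer (pigeon_enc a) = catpigeon_enc (categorize a).
Proof.
case: a => n [gs os] v.
rewrite /transduce /pigeon_enc /enc_circuit /= -!catA !foldl_cat.
(* Counter 1 is 2 because of the two gates in [header]. Output is possible only on reading a bit, so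
   the initial text depends on whether [n] starts with a one. *)
have -> : run (RStart, Store [::] [::] 0 0) (enc_nat n) =
    (RGate, Store (enc_nat 1 ++ enc_nat n ++ header) [::] 2 0).
  case: n => [|n] //=.
  by rewrite {2}/tr_step /= (@run_unary _ RGate header).
rewrite run_gates run_outputs run_target /=.
rewrite /catpigeon_enc /categorize /mux_circuit /enc_circuit /header /=.
rewrite map_cat flatten_cat rcons_cat -map_comp -!catA.
by rewrite enc_seq_cons /enc_bits enc_seq_cons. 
Qed.

(** * Translating solutions back *)

Inductive strip_state := STag | SFirst | SDrop | SNext | SKeep.

Definition strip_state_code (q : strip_state) : 'I_5 :=
  inord (match q with STag => 0 | SFirst => 1 | SDrop => 2 | SNext => 3 | SKeep => 4 end).

Lemma strip_state_codeK :
  cancel strip_state_code (fun i => nth STag [:: STag; SFirst; SDrop; SNext; SKeep] i).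
Proof. by case; rewrite /strip_state_code inordK. Qed.

HB.instance Definition _ := Finite.copy strip_state (can_type strip_state_codeK).

(** [SFirst] and [SDrop] swallow the first marker together with its bit; a terminator leads back to
    [SFirst], so the second string of a pair is treated by the same states. *)
Definition strip_delta (q : strip_state) (x : bool) : seq instr * strip_state :=
  match q, x with
  | STag, _ => ([:: Emit false x], SFirst)
  | SFirst, true => ([::], SDrop)
  | SFirst, false => ([:: Emit false false], SFirst)
  | SDrop, _ => ([::], SNext)
  | SNext, true => ([:: Emit false true], SKeep)
  | SNext, false => ([:: Emit false false], SFirst)
  | SKeep, _ => ([:: Emit false x], SNext)
  end.

Definition strip_transducer : transducer := @Transducer strip_state STag strip_delta.

Lemma strip_enc_bits (x : bits) a b p j :
  foldl (@tr_step strip_transducer) (SFirst, Store a b p j) (enc_bits x) =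
  (SFirst, Store (a ++ enc_bits (behead x)) b p j).
Proof.
case: x => [|c x] //; rewrite /enc_bits enc_seq_cons /= {2 3}/tr_step /=.
elim: x a => [|d x IHx] a //.
by rewrite enc_seq_cons /= {2 3}/tr_step /= IHx -!catA.
Qed.

Lemma transduce_strip (w : witness) :
  transduce strip_transducer (enc_witness w) = enc_witness (strip_witness w).
Proof.
rewrite /transduce; case: w => [x|x y] /=; rewrite {2}/tr_step /=.
  by rewrite strip_enc_bits /= cats0.
by rewrite foldl_cat !strip_enc_bits /= cats0.
Qed.

Theorem theorem17 : PPP_hard CategorizedPigeon.
Proof.
move=> R [f [g [f_poly g_poly f_inst g_sol]]].
exists (transduce red_transducer \o f), (fun x y => g x (transduce strip_transducer y)).
split.
- exact: polytime1_comp f_poly (polytime_transduce _).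
- exact: polytime2_comp_right (polytime_transduce _) g_poly.
- move=> x /f_inst[a a_valid fx]; exists (categorize a); first exact: categorize_valid.
  by rewrite /= fx transduce_red.
move=> x y Rx [a' [w [_ fxE -> w_sol]]]; have [a a_valid fx] := f_inst x Rx.
move: fxE; rewrite /= fx transduce_red => /catpigeon_enc_inj aE; rewrite -aE in w_sol.
apply: g_sol => //; exists a, (strip_witness w); split=> //; first exact: transduce_strip.
exact: categorize_solved.
Qed.
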